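(* Let $L\dashv N : \mathscr{A}\to \mathscr{X}$ be an adjunction between categories ($L:\mathscr{X}\to\mathscr{A}$ left adjoint to $N:\mathscr{A}\to\mathscr{X}$) with unit $\eta : 1_{\mathscr{X}}\Rightarrow NL$ and invertible counit $\varepsilon : LN \Rightarrow 1_{\mathscr{A}}$. Suppose $\mathscr{X}$ is equipped with a skew monoidal structure $(\otimes, I,\alpha,\lambda,\rho)$. Then there exists a skew monoidal structure on $\mathscr{A}$ for which $L: \mathscr{X}\to \mathscr{A}$ is normal opmonoidal (i.e. admits a normal opmonoidal structure $(\psi,\psi_0)$) with each $\psi_{X,NB}$ ($X\in\mathscr{X}$, $B\in\mathscr{A}$) invertible if and only if, for all $X\in \mathscr{X}$ and $B\in \mathscr{A}$, the morphism $$L(\eta_X\otimes 1_{NB}): L(X\otimes NB)\to L(NLX\otimes NB)$$ is invertible. In that case, the skew monoidal structure on $\mathscr{A}$ with this property is unique up to isomorphism.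
   Context: A (left) skew monoidal structure on a category $\mathscr{X}$ consists of a functor $\otimes : \mathscr{X} \times \mathscr{X} \to \mathscr{X}$, an object $I\in \mathscr{X}$, and natural families of (not necessarily invertible) morphisms $\alpha_{A,B,C} : (A\otimes B)\otimes C \to A\otimes (B\otimes C)$, $\lambda_A : I\otimes A \to A$, $\rho_A : A\to A\otimes I$, satisfying five axioms: (1) $(1_A\otimes\alpha_{B,C,D})\,\alpha_{A,B\otimes C,D}\,(\alpha_{A,B,C}\otimes 1_D)=\alpha_{A,B,C\otimes D}\,\alpha_{A\otimes B,C,D}$; (2) $\lambda_{B\otimes C}\,\alpha_{I,B,C}=\lambda_B\otimes 1_C$; (3) $(1_A\otimes\lambda_C)\,\alpha_{A,I,C}\,(\rho_A\otimes 1_C)=1_{A\otimes C}$; (4) $\alpha_{A,B,I}\,\rho_{A\otimes B}=1_A\otimes\rho_B$; (5) $\lambda_I\,\rho_I=1_I$. Let $(\mathscr{X}, \otimes, I, \alpha, \lambda,\rho)$ and $(\mathscr{A}, \bar{\otimes}, \bar{I}, \bar{\alpha}, \bar{\lambda},\bar{\rho})$ be skew monoidal categories. An opmonoidal structure on a functor $L:\mathscr{X}\to\mathscr{A}$ consists of a natural family of morphisms $\psi_{X,Y} : L(X\otimes Y)\to LX\,\bar{\otimes}\, LY$ and a morphism $\psi_0 : LI \to \bar{I}$ satisfying $(1\bar\otimes\psi_{Y,Z})\,\psi_{X,Y\otimes Z}\,L(\alpha_{X,Y,Z})=\bar\alpha_{LX,LY,LZ}\,(\psi_{X,Y}\bar\otimes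 1)\,\psi_{X\otimes Y,Z}$; $\bar\lambda_{LX}\,(\psi_0\bar\otimes 1)\,\psi_{I,X}=L(\lambda_X)$; $(1\bar\otimes\psi_0)\,\psi_{X,I}\,L(\rho_X)=\bar\rho_{LX}$. It is normal when $\psi_0$ is invertible, and strong when $\psi_0$ and all $\psi_{X,Y}$ are invertible. Two skew monoidal structures on the same category are isomorphic when the identity functor admits a strong opmonoidal structure from one to the other. *)

(* Defs.v *)
Set Implicit Arguments.
Unset Strict Implicit.
Unset Printing Implicit Defensive.

Declare Scope cat_scope.
Delimit Scope cat_scope with cat.
Local Open Scope cat_scope.

Record category := Category {
  obj :> Type;
  hom : obj -> obj -> Type;
  idm : forall a, hom a a;
  comp : forall a b c, hom b c -> hom a b -> hom a c;
  comp_id_l : forall a b (f : hom a b), comp (idm b) f = f;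
  comp_id_r : forall a b (f : hom a b), comp f (idm a) = f;
  comp_assoc : forall a b c d (h : hom c d) (g : hom b c) (f : hom a b),
    comp h (comp g f) = comp (comp h g) f
}.

Arguments hom {_} _ _.
Arguments idm {_} _.
Arguments comp {_ _ _ _} _ _.

Notation "g ∘ f" := (comp g f) (at level 40, left associativity) : cat_scope.

Definition is_iso (C : category) (a b : C) (f : hom a b) : Prop :=
  exists g : hom b a, g ∘ f = idm a /\ f ∘ g = idm b.

Record functor (C D : category) := Functor {
  fobj :> C -> D;
  fmap : forall a b : C, hom a b -> hom (fobj a) (fobj b);
  fmap_id : forall a : C, fmap (idm a) = idm (fobj a);
  fmap_comp : forall (a b c : C) (g : hom b c) (f : hom a b),
    fmap (g ∘ f) = fmap g ∘ fmap f
}.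

Arguments fmap {_ _} _ {_ _} _.

Definition functor_id (C : category) : functor C C :=
  @Functor C C (fun a => a) (fun _ _ f => f)
    (fun _ => eq_refl) (fun _ _ _ _ _ => eq_refl).

Definition functor_comp (C D E : category) (G : functor D E) (F : functor C D) :
  functor C E.
Proof.
refine (@Functor C E (fun a => G (F a)) (fun _ _ f => fmap G (fmap F f)) _ _).
- abstract (intros; now rewrite !fmap_id).
- abstract (intros; now rewrite !fmap_comp).
Defined.

Record nat_trans (C D : category) (F G : functor C D) := NatTrans {
  component :> forall a : C, hom (F a) (G a);
  naturality : forall (a b : C) (f : hom a b),
    component b ∘ fmap F f = fmap G f ∘ component a
}.

Definition prod_cat (C D : category) : category.
Proof.
refine (@Category (C * D)%type
  (fun p q => (hom (fst p) (fst q) * hom (snd p) (snd q))%type)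
  (fun p => (idm (fst p), idm (snd p)))
  (fun _ _ _ g f => (fst g ∘ fst f, snd g ∘ snd f)) _ _ _).
- abstract (intros a b [f f']; simpl; now rewrite !comp_id_l).
- abstract (intros a b [f f']; simpl; now rewrite !comp_id_r).
- abstract (intros; simpl; now rewrite !comp_assoc).
Defined.

(* [L] is left adjoint to [N]. *)
Record adjunction (X A : category) (L : functor X A) (N : functor A X) :=
  Adjunction {
  unit : nat_trans (functor_id X) (functor_comp N L);
  counit : nat_trans (functor_comp L N) (functor_id A);
  triangle_l : forall x : X, counit (L x) ∘ fmap L (unit x) = idm (L x);
  triangle_r : forall b : A, fmap N (counit b) ∘ unit (N b) = idm (N b)
}.

Definition tens (C : category) (T : functor (prod_cat C C) C) (a b : C) : C :=
  T (a, b).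

Definition tensm (C : category) (T : functor (prod_cat C C) C)
    (a a' b b' : C) (f : hom a a') (g : hom b b') :
    hom (tens T a b) (tens T a' b') :=
  @fmap _ _ T (a, b) (a', b') (f, g).

Record skew_monoidal (C : category) := SkewMonoidal {
  tensor : functor (prod_cat C C) C;
  munit : C;
  alpha : forall a b c : C,
    hom (tens tensor (tens tensor a b) c) (tens tensor a (tens tensor b c));
  lambda : forall a : C, hom (tens tensor munit a) a;
  rho : forall a : C, hom a (tens tensor a munit);
  alpha_nat : forall (a a' b b' c c' : C)
      (f : hom a a') (g : hom b b') (h : hom c c'),
    alpha a' b' c' ∘ tensm tensor (tensm tensor f g) h =
    tensm tensor f (tensm tensor g h) ∘ alpha a b c;
  lambda_nat : forall (a a' : C) (f : hom a a'),
    lambda a' ∘ tensm tensor (idm munit) f = f ∘ lambda a;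
  rho_nat : forall (a a' : C) (f : hom a a'),
    rho a' ∘ f = tensm tensor f (idm munit) ∘ rho a;
  skew_pentagon : forall a b c d : C,
    tensm tensor (idm a) (alpha b c d) ∘ alpha a (tens tensor b c) d
      ∘ tensm tensor (alpha a b c) (idm d) =
    alpha a b (tens tensor c d) ∘ alpha (tens tensor a b) c d;
  skew_lambda_alpha : forall b c : C,
    lambda (tens tensor b c) ∘ alpha munit b c =
    tensm tensor (lambda b) (idm c);
  skew_triangle : forall a c : C,
    tensm tensor (idm a) (lambda c) ∘ alpha a munit c
      ∘ tensm tensor (rho a) (idm c) =
    idm (tens tensor a c);
  skew_alpha_rho : forall a b : C,
    alpha a b munit ∘ rho (tens tensor a b) =
    tensm tensor (idm a) (rho b);
  skew_lambda_rho : lambda munit ∘ rho munit = idm munit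
}.

Notation "a ⊗[ S ] b" := (tens (tensor S) a b)
  (at level 39, left associativity, format "a  ⊗[ S ]  b") : cat_scope.
Notation "f ⊗m[ S ] g" := (tensm (tensor S) f g)
  (at level 39, left associativity, format "f  ⊗m[ S ]  g") : cat_scope.

Record opmonoidal (X A : category) (S : skew_monoidal X) (T : skew_monoidal A)
    (L : functor X A) := Opmonoidal {
  psi : forall x y : X, hom (L (x ⊗[S] y)) (L x ⊗[T] L y);
  psi0 : hom (L (munit S)) (munit T);
  psi_nat : forall (x x' y y' : X) (f : hom x x') (g : hom y y'),
    psi x' y' ∘ fmap L (f ⊗m[S] g) = (fmap L f ⊗m[T] fmap L g) ∘ psi x y;
  psi_alpha : forall x y z : X,
    (idm (L x) ⊗m[T] psi y z) ∘ psi x (y ⊗[S] z) ∘ fmap L (alpha S x y z) =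
    alpha T (L x) (L y) (L z) ∘ (psi x y ⊗m[T] idm (L z)) ∘ psi (x ⊗[S] y) z;
  psi_lambda : forall x : X,
    lambda T (L x) ∘ (psi0 ⊗m[T] idm (L x)) ∘ psi (munit S) x =
    fmap L (lambda S x);
  psi_rho : forall x : X,
    (idm (L x) ⊗m[T] psi0) ∘ psi x (munit S) ∘ fmap L (rho S x) =
    rho T (L x)
}.

Definition normal (X A : category) (S : skew_monoidal X) (T : skew_monoidal A)
    (L : functor X A) (P : opmonoidal S T L) : Prop :=
  is_iso (psi0 P).

Definition strong (X A : category) (S : skew_monoidal X) (T : skew_monoidal A)
    (L : functor X A) (P : opmonoidal S T L) : Prop :=
  is_iso (psi0 P) /\ forall x y : X, is_iso (psi P x y).

Definition skew_isomorphic (C : category) (S T : skew_monoidal C) : Prop :=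
  exists P : opmonoidal S T (functor_id C), strong P.

Definition normal_along (X A : category) (L : functor X A) (N : functor A X)
    (S : skew_monoidal X) (T : skew_monoidal A) : Prop :=
  exists P : opmonoidal S T L,
    normal P /\ forall (x : X) (b : A), is_iso (psi P x (N b)).

(* Main.v *)
From Corelib Require Import ssreflect ssrfun.
From Stdlib Require Import IndefiniteDescription.
Require Import Defs.
Local Open Scope cat_scope.
Set Implicit Arguments.
Unset Strict Implicit.
Unset Printing Implicit Defensive.

(** Write [eta] for the unit and [eps] for the (invertible) counit.  Since
    [eps] is invertible, so are all [L eta] and all [eta (N b)].

    Necessity is naturality of [psi]: in
    [psi (N (L x)) (N b) ∘ L (eta x ⊗ 1) = (L (eta x) ⊗ 1) ∘ psi x (N b)]
    everything except [L (eta x ⊗ 1)] is known to be invertible.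

    For sufficiency, put [a ⊗' b := L (N a ⊗ N b)], with unit [L I] and
    [psi x y := L (eta x ⊗ eta y)].  The hypothesis inverts
    [L (eta x ⊗ 1) : L (x ⊗ N b) -> L (N (L x) ⊗ N b)], which is exactly
    what is needed to build associativity
    [L ((N a ⊗ N b) ⊗ N c) -> L (N a ⊗ (N b ⊗ N c))] and the left unit on
    the new tensor, and it makes [psi x (N b)] invertible.  The three
    opmonoidal equations are short computations.  The five skew monoidal
    axioms are then not computed from the formulas; they are reflected along
    [psi] ([reflected_skew_monoidal]): the source of each axiom is a product
    bracketed to the left, [(a ⊗' b) ⊗' c], and with all objects in the image
    of [L ∘ N] it receives a composite such as
    [(psi x y ⊗' 1) ∘ psi (x ⊗ y) z] from [L ((x ⊗ y) ⊗ z)].  Only the second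
    index of each [psi] has to lie in the image of [N] for this composite to
    be invertible, hence cancellable, and after precomposition with it the
    opmonoidal equations turn the axiom for [a ⊗' b] into the image under [L]
    of the axiom for [S].  As every object of [A] is isomorphic to some
    [L (N b)], naturality gives the general case.

    Uniqueness works the same way.  For any structure [T] with the property,
    [(eps a ⊗ eps b) ∘ psi (N a) (N b) : L (N a ⊗ N b) -> a ⊗ b] is a natural
    isomorphism whose source does not depend on [T].  Comparing two
    structures through it gives natural isomorphisms [theta a b] from one
    tensor to the other such that [theta ∘ psi = psi'], and the same
    cancellable composites show that [theta] is opmonoidal. *)

(** * Isomorphisms *)

(** Composites are kept bracketed to the left; these two lemmas rewrite
    factors which, in that normal form, are preceded by a further map [z]. *)
Lemma ahead2 (C : category) (a b c d : C) (g : hom b c) (f : hom a b)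
    (k : hom a c) : g ∘ f = k -> forall z : hom c d, z ∘ g ∘ f = z ∘ k.
Proof. by move=> <- z; rewrite comp_assoc. Qed.

Lemma ahead3 (C : category) (a b c d e : C) (h : hom c d) (g : hom b c)
    (f : hom a b) (k : hom a d) :
  h ∘ g ∘ f = k -> forall z : hom d e, z ∘ h ∘ g ∘ f = z ∘ k.
Proof. by move=> <- z; rewrite !comp_assoc. Qed.

Lemma iso_epi (C : category) (a b c : C) (p : hom a b) (f g : hom b c) :
  is_iso p -> f ∘ p = g ∘ p -> f = g.
Proof.
move=> [q [_ pq]] e.
by rewrite -(comp_id_r f) -(comp_id_r g) -pq !comp_assoc e.
Qed.

Lemma iso_idm (C : category) (a : C) : is_iso (idm a).
Proof. by exists (idm a); rewrite comp_id_l. Qed.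

Lemma iso_comp (C : category) (a b c : C) (g : hom b c) (f : hom a b) :
  is_iso g -> is_iso f -> is_iso (g ∘ f).
Proof.
move=> [g' [g'g gg']] [f' [f'f ff']]; exists (f' ∘ g').
by rewrite !comp_assoc (ahead2 g'g) (ahead2 ff') !comp_id_r.
Qed.

Lemma iso_fmap (C D : category) (F : functor C D) (a b : C) (f : hom a b) :
  is_iso f -> is_iso (fmap F f).
Proof.
move=> [g [gf fg]]; exists (fmap F g).
by rewrite -!fmap_comp gf fg !fmap_id.
Qed.

Lemma section_iso (C : category) (a b : C) (f : hom a b) (g : hom b a) :
  g ∘ f = idm a -> is_iso g -> is_iso f.
Proof.
move=> gf [g' [g'g gg']]; exists g; split=> //.
suff -> : f = g' by [].
by rewrite -(comp_id_l f) -g'g (ahead2 gf) comp_id_r.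
Qed.

Lemma iso_cancel_l (C : category) (a b c : C) (g : hom b c) (f : hom a b) :
  is_iso g -> is_iso (g ∘ f) -> is_iso f.
Proof.
move=> [g' [g'g gg']] gf_iso.
suff -> : f = g' ∘ (g ∘ f).
  by apply: iso_comp => //; exists g.
by rewrite comp_assoc g'g comp_id_l.
Qed.

Section Inverse.
Context (C : category) (a b : C) (f : hom a b) (f_iso : is_iso f).

(** [is_iso] asserts mere existence, but the structure maps of a skew
    monoidal category are data: description turns the one into the other. *)
Definition inv : hom b a :=
  proj1_sig (constructive_indefinite_description _ f_iso).

Lemma inv_l : inv ∘ f = idm a.
Proof. by rewrite /inv; case: constructive_indefinite_description => g []. Qed.

Lemma inv_r : f ∘ inv = idm b.
Proof. by rewrite /inv; case: constructive_indefinite_description => g []. Qed.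

Lemma inv_iso : is_iso inv.
Proof. by exists f; rewrite inv_l inv_r. Qed.
End Inverse.

(** * Tensor calculus *)

Section Tensor.
Context (C : category) (T : functor (prod_cat C C) C).

Lemma tensm_id (a b : C) : tensm T (idm a) (idm b) = idm (tens T a b).
Proof. exact: (fmap_id T (a, b)). Qed.

Lemma tensm_comp (a a' a'' b b' b'' : C) (f' : hom a' a'') (f : hom a a')
    (g' : hom b' b'') (g : hom b b') :
  tensm T f' g' ∘ tensm T f g = tensm T (f' ∘ f) (g' ∘ g).
Proof.
exact: (esym (@fmap_comp _ _ T (a, b) (a', b') (a'', b'') (f', g') (f, g))).
Qed.

Lemma tensm_compl (a a' a'' b : C) (f' : hom a' a'') (f : hom a a') :
  tensm T (f' ∘ f) (idm b) = tensm T f' (idm b) ∘ tensm T f (idm b).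
Proof. by rewrite tensm_comp comp_id_l. Qed.

Lemma tensm_compr (a b b' b'' : C) (g' : hom b' b'') (g : hom b b') :
  tensm T (idm a) (g' ∘ g) = tensm T (idm a) g' ∘ tensm T (idm a) g.
Proof. by rewrite tensm_comp comp_id_l. Qed.

Lemma tensm_lr (a a' b b' : C) (f : hom a a') (g : hom b b') :
  tensm T f (idm b') ∘ tensm T (idm a) g = tensm T f g.
Proof. by rewrite tensm_comp comp_id_l comp_id_r. Qed.

Lemma tensm_rl (a a' b b' : C) (f : hom a a') (g : hom b b') :
  tensm T (idm a') g ∘ tensm T f (idm b) = tensm T f g.
Proof. by rewrite tensm_comp comp_id_l comp_id_r. Qed.

Lemma tensm_swap (a a' b b' : C) (f : hom a a') (g : hom b b') :
  tensm T f (idm b') ∘ tensm T (idm a) g =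
  tensm T (idm a') g ∘ tensm T f (idm b).
Proof. by rewrite tensm_lr tensm_rl. Qed.

Lemma iso_tensm (a a' b b' : C) (f : hom a a') (g : hom b b') :
  is_iso f -> is_iso g -> is_iso (tensm T f g).
Proof.
move=> [f' [f'f ff']] [g' [g'g gg']]; exists (tensm T f' g').
by rewrite !tensm_comp f'f ff' g'g gg' !tensm_id.
Qed.
End Tensor.

(** * Reflecting the skew monoidal axioms *)

(** The data of a skew monoidal structure with naturality but without the
    five axioms, which are to be deduced from an opmonoidal functor. *)
Record skew_data (C : category) := SkewData {
  dtensor : functor (prod_cat C C) C;
  dunit : C;
  dalpha : forall a b c : C,
    hom (tens dtensor (tens dtensor a b) c) (tens dtensor a (tens dtensor b c));
  dlambda : forall a : C, hom (tens dtensor dunit a) a;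
  drho : forall a : C, hom a (tens dtensor a dunit);
  dalpha_nat : forall (a a' b b' c c' : C)
      (f : hom a a') (g : hom b b') (h : hom c c'),
    dalpha a' b' c' ∘ tensm dtensor (tensm dtensor f g) h =
    tensm dtensor f (tensm dtensor g h) ∘ dalpha a b c;
  dlambda_nat : forall (a a' : C) (f : hom a a'),
    dlambda a' ∘ tensm dtensor (idm dunit) f = f ∘ dlambda a;
  drho_nat : forall (a a' : C) (f : hom a a'),
    drho a' ∘ f = tensm dtensor f (idm dunit) ∘ drho a
}.

Section Reflection.
Context (X A : category) (S : skew_monoidal X) (D : skew_data A)
  (L : functor X A).

Local Notation "a ⊗ b" := (tens (dtensor D) a b)
  (at level 39, left associativity).
Local Notation "f ⊗m g" := (tensm (dtensor D) f g)
  (at level 39, left associativity).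
Local Notation I := (munit S).
Local Notation J := (dunit D).
Local Notation al := (dalpha D).
Local Notation la := (dlambda D).
Local Notation rh := (drho D).
Local Notation "1" := (idm _).

Context (ps : forall x y : X, hom (L (x ⊗[S] y)) (L x ⊗ L y))
  (ps0 : hom (L I) J).

Hypothesis ps_nat : forall (x x' y y' : X) (f : hom x x') (g : hom y y'),
  ps x' y' ∘ fmap L (f ⊗m[S] g) = (fmap L f ⊗m fmap L g) ∘ ps x y.
Hypothesis ps_alpha : forall x y z : X,
  (1 ⊗m ps y z) ∘ ps x (y ⊗[S] z) ∘ fmap L (alpha S x y z) =
  al (L x) (L y) (L z) ∘ (ps x y ⊗m 1) ∘ ps (x ⊗[S] y) z.
Hypothesis ps_lambda : forall x : X,
  la (L x) ∘ (ps0 ⊗m 1) ∘ ps I x = fmap L (lambda S x).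
Hypothesis ps_rho : forall x : X,
  (1 ⊗m ps0) ∘ ps x I ∘ fmap L (rho S x) = rh (L x).

Hypothesis ps0_iso : is_iso ps0.
(* In the instance below, [y] is [N b] and [i] is the counit at [b]. *)
Hypothesis cover : forall b : A, exists (y : X) (i : hom (L y) b),
  is_iso i /\ forall x : X, is_iso (ps x y).

Lemma ps_natl (x x' y : X) (f : hom x x') :
  (fmap L f ⊗m 1) ∘ ps x y = ps x' y ∘ fmap L (f ⊗m[S] 1).
Proof. by rewrite ps_nat fmap_id. Qed.

Lemma ps_natr (x y y' : X) (g : hom y y') :
  (1 ⊗m fmap L g) ∘ ps x y = ps x y' ∘ fmap L (1 ⊗m[S] g).
Proof. by rewrite ps_nat fmap_id. Qed.

Lemma al_natl (a a' b c : A) (f : hom a a') :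
  al a' b c ∘ (f ⊗m 1 ⊗m 1) = (f ⊗m 1) ∘ al a b c.
Proof. by rewrite dalpha_nat tensm_id. Qed.

Lemma al_natm (a b b' c : A) (f : hom b b') :
  al a b' c ∘ (1 ⊗m f ⊗m 1) = (1 ⊗m (f ⊗m 1)) ∘ al a b c.
Proof. exact: dalpha_nat. Qed.

Lemma al_natr (a b c c' : A) (f : hom c c') :
  al a b c' ∘ (1 ⊗m f) = (1 ⊗m (1 ⊗m f)) ∘ al a b c.
Proof. by rewrite -dalpha_nat tensm_id. Qed.

(** Both sides are precomposed with [ps0]; [ps_rho] then exposes a second
    copy of [ps0], the one that [ps_lambda] absorbs. *)
Lemma reflect_lambda_rho : la J ∘ rh J = idm J.
Proof.
apply: (iso_epi ps0_iso); rewrite comp_id_l.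
rewrite (ahead2 (drho_nat _ _)) -ps_rho !comp_assoc.
rewrite (ahead2 (tensm_swap _ _ _)) !comp_assoc dlambda_nat.
rewrite (ahead3 (ps_lambda _)) (ahead2 (esym (fmap_comp _ _ _))).
by rewrite skew_lambda_rho fmap_id comp_id_r.
Qed.
(** The lemmas with suffix [_at] treat objects in the image of [L].  The maps
    assumed invertible are those in the composite from the [L]-image of the
    left-bracketed product in [X] to the source of the axiom; cancelling this
    composite leaves the [L]-image of the axiom for [S]. *)
Lemma reflect_alpha_rho_at (x y : X) : is_iso (ps x y) ->
  al (L x) (L y) J ∘ rh (L x ⊗ L y) = 1 ⊗m rh (L y).
Proof.
move=> p_iso; apply: (iso_epi p_iso).
rewrite (ahead2 (drho_nat _ _)) -!ps_rho !comp_assoc.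
rewrite (ahead2 (tensm_swap _ _ _)) !comp_assoc al_natr.
rewrite (ahead3 (esym (ps_alpha _ _ _))) !comp_assoc.
rewrite (ahead2 (esym (fmap_comp _ _ _))) skew_alpha_rho.
by rewrite (ahead2 (esym (ps_natr _ _))) !tensm_compr !comp_assoc.
Qed.

Lemma reflect_triangle_at (x y : X) : is_iso (ps x y) ->
  (1 ⊗m la (L y)) ∘ al (L x) J (L y) ∘ (rh (L x) ⊗m 1) = 1.
Proof.
move=> p_iso; apply: (iso_epi p_iso); rewrite comp_id_l.
rewrite -ps_rho !tensm_compl !comp_assoc (ahead2 (ps_natl _ _)) !comp_assoc.
rewrite (ahead2 (al_natm _ _ _)) !comp_assoc -tensm_compr.
rewrite (ahead3 (esym (ps_alpha _ _ _))) !comp_assoc -tensm_compr ps_lambda.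
rewrite ps_natr !(ahead2 (esym (fmap_comp _ _ _))).
by rewrite !comp_assoc skew_triangle fmap_id comp_id_r.
Qed.

Lemma reflect_lambda_alpha_at (y z : X) :
  is_iso (ps I y) -> is_iso (ps (I ⊗[S] y) z) ->
  la (L y ⊗ L z) ∘ al J (L y) (L z) = la (L y) ⊗m 1.
Proof.
move=> p_iso q_iso.
have src_iso : is_iso ((ps0 ⊗m 1 ⊗m 1) ∘ (ps I y ⊗m idm (L z))
    ∘ ps (I ⊗[S] y) z).
  by do !apply: iso_comp => //; do !apply: iso_tensm => //; apply: iso_idm.
apply: (iso_epi src_iso); rewrite !comp_assoc.
rewrite (ahead2 (al_natl _ _ _)) !comp_assoc.
rewrite (ahead3 (esym (ps_alpha _ _ _))) !comp_assoc.
rewrite (ahead2 (tensm_swap _ _ _)) !comp_assoc dlambda_nat.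
rewrite (ahead3 (ps_lambda _)) (ahead2 (esym (fmap_comp _ _ _))).
by rewrite skew_lambda_alpha -ps_natl -!tensm_compl ps_lambda.
Qed.

Lemma reflect_pentagon_at (x y z w : X) :
  is_iso (ps x y) -> is_iso (ps (x ⊗[S] y) z) ->
  is_iso (ps (x ⊗[S] y ⊗[S] z) w) ->
  (1 ⊗m al (L y) (L z) (L w)) ∘ al (L x) (L y ⊗ L z) (L w)
    ∘ (al (L x) (L y) (L z) ⊗m 1) =
  al (L x) (L y) (L z ⊗ L w) ∘ al (L x ⊗ L y) (L z) (L w).
Proof.
move=> p_iso q_iso r_iso.
have src_iso : is_iso ((ps x y ⊗m 1 ⊗m 1) ∘ (ps (x ⊗[S] y) z ⊗m idm (L w))
    ∘ ps (x ⊗[S] y ⊗[S] z) w).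
  by do !apply: iso_comp => //; do !apply: iso_tensm => //; apply: iso_idm.
apply: (iso_epi src_iso); rewrite !comp_assoc.
(* Both sides reduce to the [L]-image of one side of the pentagon in [X]
   followed by the canonical map to the right-bracketed product. *)
transitivity ((1 ⊗m (1 ⊗m ps z w)) ∘ (1 ⊗m ps y (z ⊗[S] w))
    ∘ ps x (y ⊗[S] (z ⊗[S] w))
    ∘ fmap L (alpha S x y (z ⊗[S] w) ∘ alpha S (x ⊗[S] y) z w)).
- rewrite -skew_pentagon !fmap_comp !comp_assoc.
  rewrite (ahead2 (esym (ps_natr _ _))) !comp_assoc -!tensm_compr ps_alpha.
  rewrite !tensm_compr.
  rewrite (ahead3 (ps_alpha _ _ _)) !comp_assoc (ahead2 (esym (al_natm _ _ _))).
  rewrite !comp_assoc (ahead2 (esym (ps_natl _ _))) !comp_assoc.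
  by rewrite !(ahead2 (esym (tensm_compl _ _ _ _))) !comp_assoc ps_alpha.
- rewrite fmap_comp !comp_assoc (ahead3 (ps_alpha _ _ _)) !comp_assoc.
  rewrite -al_natr (ahead2 (esym (tensm_swap _ _ _))) !comp_assoc.
  rewrite (ahead3 (ps_alpha _ _ _)) !comp_assoc.
  by rewrite (ahead2 (esym (al_natl _ _ _))) !comp_assoc.
Qed.

(** Arbitrary objects are replaced by objects in the image of [L] along the
    isomorphisms given by [cover]; this is legitimate because both sides of
    each axiom are natural. *)
Lemma reflect_alpha_rho (a b : A) : al a b J ∘ rh (a ⊗ b) = 1 ⊗m rh b.
Proof.
have [x [i [i_iso _]]] := cover a; have [y [j [j_iso good_y]]] := cover b.
apply: (iso_epi (iso_tensm (dtensor D) i_iso j_iso)).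
rewrite (ahead2 (drho_nat _ _)) !comp_assoc dalpha_nat.
rewrite (ahead2 (reflect_alpha_rho_at (good_y x))) !tensm_comp.
by rewrite drho_nat comp_id_l comp_id_r.
Qed.

Lemma reflect_triangle (a b : A) :
  (1 ⊗m la b) ∘ al a J b ∘ (rh a ⊗m 1) = idm (a ⊗ b).
Proof.
have [x [i [i_iso _]]] := cover a; have [y [j [j_iso good_y]]] := cover b.
apply: (iso_epi (iso_tensm (dtensor D) i_iso j_iso)).
rewrite (ahead2 (tensm_comp _ _ _ _ _)) drho_nat comp_id_l.
rewrite -{1}(comp_id_r j) -tensm_comp !comp_assoc (ahead2 (dalpha_nat _ _ _ _)).
rewrite !comp_assoc tensm_comp dlambda_nat comp_id_l.
rewrite -{1}(comp_id_r i) -tensm_comp.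
by rewrite (ahead3 (reflect_triangle_at (good_y x))) comp_id_l comp_id_r.
Qed.

Lemma reflect_lambda_alpha (b c : A) : la (b ⊗ c) ∘ al J b c = la b ⊗m 1.
Proof.
have [y [j [j_iso good_y]]] := cover b; have [z [k [k_iso good_z]]] := cover c.
apply: (iso_epi (iso_tensm (dtensor D)
  (iso_tensm (dtensor D) (iso_idm J) j_iso) k_iso)).
rewrite (ahead2 (dalpha_nat _ _ _ _)) !comp_assoc dlambda_nat.
rewrite (ahead2 (reflect_lambda_alpha_at (good_y _) (good_z _))) !tensm_comp.
by rewrite dlambda_nat comp_id_l comp_id_r.
Qed.

Lemma reflect_pentagon (a b c d : A) :
  (1 ⊗m al b c d) ∘ al a (b ⊗ c) d ∘ (al a b c ⊗m 1) =
  al a b (c ⊗ d) ∘ al (a ⊗ b) c d.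
Proof.
have [x [i [i_iso _]]] := cover a; have [y [j [j_iso good_y]]] := cover b.
have [z [k [k_iso good_z]]] := cover c; have [w [l [l_iso good_w]]] := cover d.
apply: (iso_epi (iso_tensm (dtensor D) (iso_tensm (dtensor D)
  (iso_tensm (dtensor D) i_iso j_iso) k_iso) l_iso)).
rewrite (ahead2 (tensm_comp _ _ _ _ _)) dalpha_nat comp_id_l.
rewrite -{1}(comp_id_r l) -tensm_comp !comp_assoc (ahead2 (dalpha_nat _ _ _ _)).
rewrite !comp_assoc tensm_comp dalpha_nat comp_id_l.
rewrite -{1}(comp_id_r i) -tensm_comp.
rewrite (ahead3 (reflect_pentagon_at (good_y _) (good_z _) (good_w _))).
by rewrite (ahead2 (dalpha_nat _ _ _ _)) !comp_assoc dalpha_nat.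
Qed.

Definition reflected_skew_monoidal : skew_monoidal A :=
  SkewMonoidal (@dalpha_nat _ D) (@dlambda_nat _ D) (@drho_nat _ D)
    reflect_pentagon reflect_lambda_alpha reflect_triangle reflect_alpha_rho
    reflect_lambda_rho.

Definition reflecting_opmonoidal : opmonoidal S reflected_skew_monoidal L :=
  @Opmonoidal _ _ S reflected_skew_monoidal L ps ps0
    ps_nat ps_alpha ps_lambda ps_rho.
End Reflection.

(** * The reflected tensor product *)

Section Adjunction.
Context (X A : category) (L : functor X A) (N : functor A X)
  (adj : adjunction L N).

Definition eta (x : X) : hom x (N (L x)) := unit adj x.
Definition eps (b : A) : hom (L (N b)) b := counit adj b.

Lemma eta_nat (x y : X) (f : hom x y) :
  eta y ∘ f = fmap N (fmap L f) ∘ eta x.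
Proof. exact: (naturality (unit adj) f). Qed.

Lemma eps_nat (a b : A) (f : hom a b) :
  eps b ∘ fmap L (fmap N f) = f ∘ eps a.
Proof. exact: (naturality (counit adj) f). Qed.

Lemma eps_eta (x : X) : eps (L x) ∘ fmap L (eta x) = idm (L x).
Proof. exact: triangle_l. Qed.

Lemma Neps_eta (b : A) : fmap N (eps b) ∘ eta (N b) = idm (N b).
Proof. exact: triangle_r. Qed.

Context (eps_iso : forall b : A, is_iso (eps b)).

Lemma Leta_iso (x : X) : is_iso (fmap L (eta x)).
Proof. exact: section_iso (eps_eta x) (eps_iso _). Qed.

Lemma etaN_iso (b : A) : is_iso (eta (N b)).
Proof. exact: section_iso (Neps_eta b) (iso_fmap N (eps_iso b)). Qed.

Context (S : skew_monoidal X).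

Local Notation "a ⊗ b" := (tens (tensor S) a b)
  (at level 39, left associativity).
Local Notation "f ⊗m g" := (tensm (tensor S) f g)
  (at level 39, left associativity).
Local Notation I := (munit S).
Local Notation "1" := (idm _).

Context (loc_iso :
  forall (x : X) (b : A), is_iso (fmap L (eta x ⊗m idm (N b)))).

(** Removes a superfluous reflection [N (L x)] from a left tensor factor. *)
Definition unloc (x : X) (b : A) : hom (L (N (L x) ⊗ N b)) (L (x ⊗ N b)) :=
  inv (loc_iso x b).

Definition counit_inv (b : A) : hom b (L (N b)) := inv (eps_iso b).

Lemma unloc_nat (x x' : X) (b b' : A) (f : hom x x') (g : hom (N b) (N b')) :
  unloc x' b' ∘ fmap L (fmap N (fmap L f) ⊗m g) = fmap L (f ⊗m g) ∘ unloc x b.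
Proof.
apply: (iso_epi (loc_iso x b)).
rewrite (ahead2 (inv_l _)) comp_id_r (ahead2 (esym (fmap_comp L _ _))).
rewrite tensm_comp -eta_nat comp_id_r -(tensm_lr _ (eta x' ∘ f)) tensm_compl.
rewrite -comp_assoc tensm_lr fmap_comp comp_assoc.
by rewrite inv_l comp_id_l.
Qed.

Lemma unloc_eta (x : X) (b : A) (y : X) (g : hom y (N b)) :
  unloc x b ∘ fmap L (eta x ⊗m g) = fmap L (1 ⊗m g).
Proof.
by rewrite -tensm_lr fmap_comp comp_assoc inv_l comp_id_l.
Qed.

(** On the image of [L] the inverse counit is the unit, by the first triangle
    identity; this is why [loc_rho] is compatible with [loc_psi]. *)
Lemma counit_inv_L (x : X) : counit_inv (L x) = fmap L (eta x).
Proof.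
apply: (iso_epi (eps_iso _)); rewrite inv_l.
apply: (iso_epi (Leta_iso _)).
by rewrite (ahead2 (eps_eta _)) comp_id_l comp_id_r.
Qed.

Lemma counit_inv_nat (a b : A) (f : hom a b) :
  counit_inv b ∘ f = fmap L (fmap N f) ∘ counit_inv a.
Proof.
apply: (iso_epi (eps_iso a)).
by rewrite (ahead2 (inv_l _)) comp_id_r (ahead2 (esym (eps_nat _)))
  comp_assoc inv_l comp_id_l.
Qed.

Definition loc_tensor : functor (prod_cat A A) A.
Proof.
refine (@Functor (prod_cat A A) A (fun p => L (N (fst p) ⊗ N (snd p)))
  (fun p q f => fmap L (fmap N (fst f) ⊗m fmap N (snd f))) _ _).
- abstract (by move=> [a b] /=; rewrite !fmap_id tensm_id fmap_id).
- abstract (by move=> *; rewrite /= -(fmap_comp L) tensm_comp !fmap_comp).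
Defined.

Definition loc_alpha (a b c : A) :
    hom (L (N (L (N a ⊗ N b)) ⊗ N c)) (L (N a ⊗ N (L (N b ⊗ N c)))) :=
  fmap L (1 ⊗m eta (N b ⊗ N c)) ∘ fmap L (alpha S (N a) (N b) (N c))
    ∘ unloc (N a ⊗ N b) c.

Definition loc_lambda (a : A) : hom (L (N (L I) ⊗ N a)) a :=
  eps a ∘ fmap L (lambda S (N a)) ∘ unloc I a.

Definition loc_rho (a : A) : hom a (L (N a ⊗ N (L I))) :=
  fmap L (1 ⊗m eta I) ∘ fmap L (rho S (N a)) ∘ counit_inv a.

Lemma loc_alpha_nat (a a' b b' c c' : A)
    (f : hom a a') (g : hom b b') (h : hom c c') :
  loc_alpha a' b' c' ∘
    fmap L (fmap N (fmap L (fmap N f ⊗m fmap N g)) ⊗m fmap N h) =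
  fmap L (fmap N f ⊗m fmap N (fmap L (fmap N g ⊗m fmap N h)))
    ∘ loc_alpha a b c.
Proof.
rewrite /loc_alpha (ahead2 (unloc_nat _ _)) !comp_assoc; congr (_ ∘ _).
rewrite -!(fmap_comp L); congr (fmap L _).
by rewrite -!comp_assoc alpha_nat !comp_assoc !tensm_comp
  comp_id_l comp_id_r eta_nat.
Qed.

Lemma loc_lambda_nat (a a' : A) (f : hom a a') :
  loc_lambda a' ∘ fmap L (fmap N (idm (L I)) ⊗m fmap N f) = f ∘ loc_lambda a.
Proof.
rewrite /loc_lambda -(fmap_id L I) (ahead2 (unloc_nat _ _)) !comp_assoc.
rewrite (ahead2 (esym (fmap_comp L _ _))) lambda_nat fmap_comp !comp_assoc.
by rewrite eps_nat.
Qed.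

Lemma loc_rho_nat (a a' : A) (f : hom a a') :
  loc_rho a' ∘ f = fmap L (fmap N f ⊗m fmap N (idm (L I))) ∘ loc_rho a.
Proof.
rewrite /loc_rho (ahead2 (counit_inv_nat _)) !comp_assoc; congr (_ ∘ _).
rewrite -!(fmap_comp L); congr (fmap L _).
by rewrite -comp_assoc rho_nat !comp_assoc !tensm_comp
  !fmap_id !comp_id_l !comp_id_r.
Qed.

Definition loc_data : skew_data A :=
  @SkewData A loc_tensor (L I) loc_alpha loc_lambda loc_rho
    loc_alpha_nat loc_lambda_nat loc_rho_nat.

Definition loc_psi (x y : X) : hom (L (x ⊗ y)) (L (N (L x) ⊗ N (L y))) :=
  fmap L (eta x ⊗m eta y).

Lemma loc_psi_nat (x x' y y' : X) (f : hom x x') (g : hom y y') :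
  loc_psi x' y' ∘ fmap L (f ⊗m g) =
  fmap L (fmap N (fmap L f) ⊗m fmap N (fmap L g)) ∘ loc_psi x y.
Proof. by rewrite -!(fmap_comp L) !tensm_comp !eta_nat. Qed.

Lemma loc_psi_alpha (x y z : X) :
  fmap L (fmap N (idm (L x)) ⊗m fmap N (loc_psi y z)) ∘ loc_psi x (y ⊗ z)
    ∘ fmap L (alpha S x y z) =
  loc_alpha (L x) (L y) (L z)
    ∘ fmap L (fmap N (loc_psi x y) ⊗m fmap N (idm (L z)))
    ∘ loc_psi (x ⊗ y) z.
Proof.
transitivity (fmap L ((eta x ⊗m (eta _ ∘ (eta y ⊗m eta z))) ∘ alpha S x y z)).
- rewrite /loc_psi -!(fmap_comp L) fmap_id tensm_comp comp_id_l.
  by rewrite -eta_nat.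
(* Naturality of [eta] at [eta x ⊗m eta y] moves the unit of the product to
   the outside, where [unloc] cancels it. *)
- have step : fmap L (fmap N (loc_psi x y) ⊗m fmap N (idm (L z)))
      ∘ loc_psi (x ⊗ y) z =
    fmap L (eta _ ⊗m 1) ∘ fmap L (eta x ⊗m eta y ⊗m eta z).
    rewrite /loc_psi -!(fmap_comp L) !tensm_comp -eta_nat fmap_id.
    by rewrite !comp_id_l.
  rewrite /loc_alpha (ahead2 step) !comp_assoc (ahead2 (inv_l _)) comp_id_r.
  rewrite -!(fmap_comp L) -comp_assoc alpha_nat comp_assoc tensm_comp.
  by rewrite comp_id_l.
Qed.

Lemma loc_psi_lambda (x : X) :
  loc_lambda (L x) ∘ fmap L (fmap N (idm (L I)) ⊗m fmap N (idm (L x)))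
    ∘ loc_psi I x = fmap L (lambda S x).
Proof.
rewrite !fmap_id tensm_id fmap_id comp_id_r /loc_lambda /loc_psi.
rewrite (ahead2 (unloc_eta _ _)) (ahead2 (esym (fmap_comp L _ _))) lambda_nat.
by rewrite fmap_comp comp_assoc eps_eta comp_id_l.
Qed.

Lemma loc_psi_rho (x : X) :
  fmap L (fmap N (idm (L x)) ⊗m fmap N (idm (L I))) ∘ loc_psi x I
    ∘ fmap L (rho S x) = loc_rho (L x).
Proof.
rewrite !fmap_id tensm_id fmap_id comp_id_l /loc_rho counit_inv_L /loc_psi.
rewrite -!(fmap_comp L) -(comp_assoc _ _ (eta x)) rho_nat comp_assoc.
by rewrite tensm_rl.
Qed.

(** The factor [L (eta x ⊗ 1)] is invertible by hypothesis, and
    [eta (N b)] because it is a section of the isomorphism [N (eps b)]. *)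
Lemma loc_psi_iso (x : X) (b : A) : is_iso (loc_psi x (N b)).
Proof.
rewrite /loc_psi -tensm_rl fmap_comp; apply: iso_comp (loc_iso x b).
by apply/iso_fmap/iso_tensm; [apply: iso_idm | apply: etaN_iso].
Qed.

Lemma loc_cover (b : A) : exists (y : X) (i : hom (L y) b),
  is_iso i /\ forall x : X, is_iso (loc_psi x y).
Proof. by exists (N b), (eps b); split=> // x; apply: loc_psi_iso. Qed.

Definition loc_skew_monoidal : skew_monoidal A :=
  @reflected_skew_monoidal X A S loc_data L loc_psi (idm _)
    loc_psi_nat loc_psi_alpha loc_psi_lambda loc_psi_rho (iso_idm _) loc_cover.

Lemma loc_normal_along : normal_along L N S loc_skew_monoidal.
Proof.
exists (@reflecting_opmonoidal X A S loc_data L loc_psi (idm _)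
    loc_psi_nat loc_psi_alpha loc_psi_lambda loc_psi_rho (iso_idm _) loc_cover).
by split=> [|x b]; [apply: iso_idm | apply: loc_psi_iso].
Qed.
(** * Uniqueness up to isomorphism *)

Section Formula.
Context (T : skew_monoidal A) (P : opmonoidal S T L).

(** For a structure with the required property this is an isomorphism, so its
    source shows what the tensor of [T] must be. *)
Definition tensor_formula (a b : A) : hom (L (N a ⊗ N b)) (a ⊗[T] b) :=
  (eps a ⊗m[T] eps b) ∘ psi P (N a) (N b).

Lemma tensor_formula_nat (a a' b b' : A) (f : hom a a') (g : hom b b') :
  tensor_formula a' b' ∘ fmap L (fmap N f ⊗m fmap N g) =
  (f ⊗m[T] g) ∘ tensor_formula a b.
Proof.
rewrite /tensor_formula (ahead2 (psi_nat _ _ _)) !comp_assoc.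
by rewrite !tensm_comp !eps_nat.
Qed.

(** All of [psi] is recovered from the components that enter
    [tensor_formula]; hence a comparison of tensors compatible with the latter
    is compatible with the former. *)
Lemma tensor_formula_psi (x y : X) :
  tensor_formula (L x) (L y) ∘ fmap L (eta x ⊗m eta y) = psi P x y.
Proof.
rewrite /tensor_formula (ahead2 (psi_nat _ _ _)) !comp_assoc.
by rewrite tensm_comp !eps_eta tensm_id comp_id_l.
Qed.

Lemma tensor_formula_iso (a b : A) :
  is_iso (psi P (N a) (N b)) -> is_iso (tensor_formula a b).
Proof. by move=> psi_iso; apply: iso_comp => //; apply: iso_tensm. Qed.

(** Naturality of [psi] in [eta x], and cancellation. *)
Lemma unit_tensor_iso :
  (forall (x : X) (b : A), is_iso (psi P x (N b))) ->
  forall (x : X) (b : A), is_iso (fmap L (eta x ⊗m idm (N b))).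
Proof.
move=> psi_iso x b; apply: (iso_cancel_l (psi_iso _ _)).
rewrite psi_nat; apply: iso_comp => //; apply: iso_tensm.
  exact: Leta_iso.
by rewrite fmap_id; apply: iso_idm.
Qed.
End Formula.

Section Comparison.
Context (T T' : skew_monoidal A)
  (P : opmonoidal S T L) (P' : opmonoidal S T' L).
Hypotheses (P_normal : is_iso (psi0 P))
  (P_iso : forall (x : X) (b : A), is_iso (psi P x (N b))).

(** Any natural comparison of the two tensors that carries [psi P] to [psi P']
    is opmonoidal over the identity functor.  Each law is checked after
    precomposition with an isomorphism from an object [L _], where the laws of
    [P] and [P'] give the same map on both sides. *)
Section Laws.
Context (theta : forall a b : A, hom (a ⊗[T] b) (a ⊗[T'] b))
  (theta0 : hom (munit T) (munit T')).
Hypothesis theta_nat : forall (a a' b b' : A) (f : hom a a') (g : hom b b'),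
  theta a' b' ∘ (f ⊗m[T] g) = (f ⊗m[T'] g) ∘ theta a b.
Hypothesis theta_psi : forall x y : X,
  theta (L x) (L y) ∘ psi P x y = psi P' x y.
Hypothesis theta0_psi0 : theta0 ∘ psi0 P = psi0 P'.

Lemma theta_alpha (a b c : A) :
  (1 ⊗m[T'] theta b c) ∘ theta a (b ⊗[T] c) ∘ alpha T a b c =
  alpha T' a b c ∘ (theta a b ⊗m[T'] 1) ∘ theta (a ⊗[T] b) c.
Proof.
have p_iso : is_iso (((eps a ⊗m[T] eps b) ⊗m[T] eps c)
    ∘ (psi P (N a) (N b) ⊗m[T] idm (L (N c))) ∘ psi P (N a ⊗ N b) (N c)).
  do !apply: iso_comp => //; do !apply: iso_tensm => //; exact: iso_idm.
apply: (iso_epi p_iso); rewrite !comp_assoc.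
transitivity ((eps a ⊗m[T'] (eps b ⊗m[T'] eps c))
    ∘ (1 ⊗m[T'] psi P' (N b) (N c)) ∘ psi P' (N a) (N b ⊗ N c)
    ∘ fmap L (alpha S (N a) (N b) (N c))).
- rewrite (ahead2 (alpha_nat _ _ _ _)) !comp_assoc.
  rewrite (ahead3 (esym (psi_alpha _ _ _ _))) !comp_assoc.
  rewrite (ahead2 (theta_nat _ _)) !comp_assoc (ahead2 (theta_nat _ _)).
  rewrite !comp_assoc (ahead2 (theta_psi _ _)) !tensm_comp.
  by rewrite theta_nat (ahead2 (theta_psi _ _)) !comp_id_l !comp_id_r.
- rewrite (ahead3 (psi_alpha _ _ _ _)) !comp_assoc -alpha_nat.
  rewrite (ahead2 (theta_nat _ _)) !comp_assoc (ahead2 (theta_nat _ _)).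
  rewrite !comp_assoc (ahead2 (theta_psi _ _)).
  rewrite !(ahead2 (tensm_comp _ _ _ _ _)) (comp_assoc (theta a b)) theta_nat.
  by rewrite (ahead2 (theta_psi _ _)) !comp_id_l !comp_id_r.
Qed.

Lemma theta_lambda (a : A) :
  lambda T' a ∘ (theta0 ⊗m[T'] idm a) ∘ theta (munit T) a = lambda T a.
Proof.
have p_iso : is_iso ((psi0 P ⊗m[T] eps a) ∘ psi P I (N a)).
  by apply: iso_comp => //; apply: iso_tensm.
apply: (iso_epi p_iso); rewrite !comp_assoc.
rewrite (ahead2 (theta_nat _ _)) !comp_assoc (ahead2 (theta_psi _ _)).
rewrite (ahead2 (tensm_comp _ _ _ _ _)) theta0_psi0 comp_id_l.
rewrite -[in LHS]tensm_rl -[in RHS]tensm_rl !comp_assoc !lambda_nat.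
by rewrite (ahead3 (psi_lambda _ _)) (ahead3 (psi_lambda _ _)).
Qed.

Lemma theta_rho (a : A) :
  (idm a ⊗m[T'] theta0) ∘ theta a (munit T) ∘ rho T a = rho T' a.
Proof.
apply: (iso_epi (eps_iso a)).
rewrite (ahead2 (rho_nat _ _)) -(psi_rho P) rho_nat -(psi_rho P') !comp_assoc.
rewrite (ahead2 (theta_nat _ _)) !comp_assoc (ahead2 (theta_nat _ _)).
rewrite !comp_assoc (ahead2 (theta_psi _ _)) !tensm_comp.
by rewrite !comp_id_l !comp_id_r theta0_psi0.
Qed.

Definition comparison_opmonoidal : opmonoidal T T' (functor_id A) :=
  @Opmonoidal _ _ T T' (functor_id A) theta theta0
    theta_nat theta_alpha theta_lambda theta_rho.
End Laws.

Definition comparison (a b : A) : hom (a ⊗[T] b) (a ⊗[T'] b) :=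
  tensor_formula P' a b ∘ inv (tensor_formula_iso (P_iso (N a) b)).

Definition comparison0 : hom (munit T) (munit T') := psi0 P' ∘ inv P_normal.

Lemma comparison0_psi0 : comparison0 ∘ psi0 P = psi0 P'.
Proof. by rewrite /comparison0 (ahead2 (inv_l _)) comp_id_r. Qed.

Lemma comparison_formula (a b : A) :
  comparison a b ∘ tensor_formula P a b = tensor_formula P' a b.
Proof. by rewrite /comparison (ahead2 (inv_l _)) comp_id_r. Qed.

Lemma comparison_psi (x y : X) :
  comparison (L x) (L y) ∘ psi P x y = psi P' x y.
Proof. by rewrite -!tensor_formula_psi comp_assoc comparison_formula. Qed.

Lemma comparison_nat (a a' b b' : A) (f : hom a a') (g : hom b b') :
  comparison a' b' ∘ (f ⊗m[T] g) = (f ⊗m[T'] g) ∘ comparison a b.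
Proof.
apply: (iso_epi (tensor_formula_iso (P_iso (N a) b))).
rewrite (ahead2 (esym (tensor_formula_nat _ _ _))) comp_assoc.
rewrite comparison_formula (ahead2 (comparison_formula _ _)).
exact: tensor_formula_nat.
Qed.

Lemma skew_isomorphic_comparison :
  is_iso (psi0 P') -> (forall (x : X) (b : A), is_iso (psi P' x (N b))) ->
  skew_isomorphic T T'.
Proof.
move=> P'_normal P'_iso.
exists (comparison_opmonoidal comparison_nat comparison_psi comparison0_psi0).
split=> [|a b]; apply: iso_comp => //; try exact: inv_iso.
exact: tensor_formula_iso.
Qed.
End Comparison.
End Adjunction.

Theorem theorem2p1 (X A : category) (L : functor X A) (N : functor A X)
    (adj : adjunction L N)
    (counit_iso : forall b : A, is_iso (counit adj b))
    (S : skew_monoidal X) :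
  ((exists T : skew_monoidal A, normal_along L N S T) <->
   (forall (x : X) (b : A),
      is_iso (fmap L (unit adj x ⊗m[S] idm (N b))))) /\
  ((forall (x : X) (b : A),
      is_iso (fmap L (unit adj x ⊗m[S] idm (N b)))) ->
   forall T T' : skew_monoidal A,
     normal_along L N S T -> normal_along L N S T' -> skew_isomorphic T T').
Proof.
split; first split.
- by move=> [T [P [_ P_iso]]]; apply: (unit_tensor_iso counit_iso P_iso).
- move=> H; exists (@loc_skew_monoidal _ _ _ _ adj counit_iso S H).
  exact: loc_normal_along.
- move=> _ T T' [P [P_normal P_iso]] [P' [P'_normal P'_iso]].
  exact: (skew_isomorphic_comparison counit_iso P_normal P_iso P'_normal P'_iso).
Qed.
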